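(* Let $n\ge2$. For every $m\in\mathbb{N}$, $\mathbb{Z}^m$ quasi-isometrically embeds into $\mathrm{Cay}(F_n,\mathrm{sep}_n)$.
   Context: $F_n$ is the free group of rank $n$. A free factor is a subgroup generated by a subset of a basis; it is proper if it is not all of $F_n$. An element of $F_n$ is separable if it lies in a proper free factor; $\mathrm{sep}_n$ denotes the set of separable elements (a conjugation invariant generating set). $\mathrm{Cay}(G,S)$ is the graph with vertex set $G$ and an undirected edge between $g$ and $sg$ for $g\in G$, $s\in S$, with the path metric; $\mathbb Z^m$ has the $\ell^1$ metric. *)

(* Defs.v *)
From mathcomp Require Import all_boot all_order all_algebra.
Set Implicit Arguments. Unset Strict Implicit. Unset Printing Implicit Defensive.
Import Order.TTheory GRing.Theory Num.Theory.

(* letters of F_n: (i, false) = x_i, (i, true) = x_i^-1 *)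
Definition letter (n : nat) := ('I_n * bool)%type.
Definition inv_letter n (x : letter n) : letter n := (x.1, ~~ x.2).

(* words; elements of F_n are the freely reduced words *)
Definition word (n : nat) := seq (letter n).
Definition reduced n (w : word n) : bool :=
  sorted (fun x y : letter n => y != inv_letter x) w.

Definition cons_red n (x : letter n) (w : word n) : word n :=
  match w with
  | y :: w' => if y == inv_letter x then w' else x :: w
  | [::] => [:: x]
  end.
Definition fmul n (u v : word n) : word n := foldr (@cons_red n) v u.
Definition finv n (u : word n) : word n := rev (map (@inv_letter n) u).

Definition feval n (B : 'I_n -> word n) (w : word n) : word n :=
  foldr (fun x acc => fmul (if x.2 then finv (B x.1) else B x.1) acc) [::] w.

Definition is_basis n (B : 'I_n -> word n) : Prop :=
  (forall i, reduced (B i)) /\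
  (forall u v : word n, reduced u -> reduced v -> feval B u = feval B v -> u = v) /\
  (forall g : word n, reduced g -> exists w, reduced w /\ feval B w = g).

Definition free_factor n (B : 'I_n -> word n) (S : {set 'I_n}) (g : word n) : Prop :=
  exists w : word n, all (fun x : letter n => x.1 \in S) w /\ feval B w = g.

Definition proper_free_factor n (B : 'I_n -> word n) (S : {set 'I_n}) : Prop :=
  exists g : word n, reduced g /\ ~ free_factor B S g.

Definition separable n (g : word n) : Prop :=
  reduced g /\
  exists (B : 'I_n -> word n) (S : {set 'I_n}),
    is_basis B /\ proper_free_factor B S /\ free_factor B S g.

(* distance in Cay(F_n, sep_n) is at most k: a path of at most k edges from g
   to h; each edge goes from a to s a or from s a to a (undirected), s separable *)
Definition step n (e : word n * bool) : word n := if e.2 then finv e.1 else e.1.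
Definition cay_dist_le n (g h : word n) (k : nat) : Prop :=
  exists path : seq (word n * bool),
    size path <= k /\ (forall e, e \in path -> separable e.1) /\
    h = foldr (fun e acc => fmul (step e) acc) g path.

Definition l1dist m (x y : 'I_m -> int) : nat := \sum_(i < m) `|x i - y i|%N.

(* quasi-isometric embedding Z^m -> Cay(F_n, sep_n), with constants L, C:
   |x-y|/L - C <= d(f x, f y) <= L |x-y| + C *)
Definition qi_embedding n m (f : ('I_m -> int) -> word n) : Prop :=
  (forall x, reduced (f x)) /\
  exists L C : nat, 0 < L /\
    forall x y : 'I_m -> int,
      cay_dist_le (f x) (f y) (L * l1dist x y + C) /\
      (forall k, cay_dist_le (f x) (f y) k -> l1dist x y <= L * (k + C)).

(* Main.v *)
Require Import Defs.
From mathcomp Require Import all_boot all_order all_algebra.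
From mathcomp Require Import zify.
Set Implicit Arguments. Unset Strict Implicit. Unset Printing Implicit Defensive.

(** The metric is bi-invariant, so for positive words g_1, ..., g_m the map
    x |-> g_1^(x_1) ... g_m^(x_m) is Lipschitz. The lower bound comes from Brooks'
    counting quasimorphisms brooks(g_i), once they are known to be bounded on
    separable elements. Choose all g_i of the same length, containing every
    positive two-letter word, and pairwise distinguished by the number of
    occurrences of one letter: then g_i is no subword of a power of g_j for i <> j,
    so brooks(g_i) detects exactly the coordinate x_i.

    Boundedness on separable elements is a case of Whitehead's cut vertex lemma.
    Let g be cyclically reduced in the factor H of F = H * <t>, and suppose that g
    contains every positive two-letter word. An edge of the Bass-Serre tree of this
    splitting colours F in two colours; the colour is H-invariant and locally
    constant far away from 1 in the Cayley tree, and both colours occur far away.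
    The two ends of each translate of the axis of g have the same colour, and these
    axes connect the outgoing directions at every vertex. By descending induction
    on the distance from 1 all cones are monochromatic, a contradiction. Hence
    neither g nor g^-1 contains g_i, and conjugating changes brooks(g_i) by a
    bounded amount only. *)

(* mathcomp's fingraph.finv would otherwise take precedence. *)
Local Notation finv := Defs.finv.

(** * Reduced words *)

Section FreeGroup.
Variable n : nat.
Implicit Types (x y z : letter n) (u v w g : word n).

Lemma inv_letterK : involutive (@inv_letter n).
Proof. by case=> i b; rewrite /inv_letter /= negbK. Qed.

Lemma inv_letter_neq x : (inv_letter x == x) = false.
Proof. by case: x => i b; rewrite /inv_letter xpair_eqE eqxx; case: b. Qed.

Lemma reduced_cons2 x y w :
  reduced (x :: y :: w) = (y != inv_letter x) && reduced (y :: w).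
Proof. by []. Qed.

Lemma reduced_behead x w : reduced (x :: w) -> reduced w.
Proof. exact: path_sorted. Qed.

Lemma reduced_cat_cons u x v :
  reduced (u ++ x :: v) = reduced (rcons u x) && reduced (x :: v).
Proof. exact: sorted_cat_cons. Qed.

Lemma reduced_infix u v : infix u v -> reduced v -> reduced u.
Proof.
by move=> /infixP[s [t ->]] /cat_sorted2[_] /cat_sorted2[].
Qed.

Lemma finvK : involutive (@Defs.finv n).
Proof. by move=> u; rewrite /finv map_rev revK mapK //; apply: inv_letterK. Qed.

Lemma finv_cons x u : finv (x :: u) = rcons (finv u) (inv_letter x).
Proof. by rewrite /finv /= rev_cons. Qed.

Lemma finv_cat u v : finv (u ++ v) = finv v ++ finv u.
Proof. by rewrite /finv map_cat rev_cat. Qed.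

Lemma size_finv u : size (finv u) = size u.
Proof. by rewrite size_rev size_map. Qed.

Lemma reduced_finv u : reduced (finv u) = reduced u.
Proof.
rewrite /reduced /finv rev_sorted sorted_map; apply: eq_sorted => x y /=.
by rewrite inv_letterK eq_sym -(inj_eq (can_inj inv_letterK)) inv_letterK.
Qed.

Lemma cons_red_reduced x w : reduced w -> reduced (cons_red x w).
Proof.
case: w => //= y w rw; case: ifPn => [_|neq]; first exact: reduced_behead rw.
by rewrite reduced_cons2 neq.
Qed.

Lemma cons_red_id x w : reduced (x :: w) -> cons_red x w = x :: w.
Proof. by case: w => //= y w /andP[/negPf->]. Qed.

Lemma cons_redK x w : reduced w -> cons_red x (cons_red (inv_letter x) w) = w.
Proof.
case: w => [|y w] rw /=; first by rewrite eqxx.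
rewrite inv_letterK; case: eqP => [eq_yx|_]; last by rewrite /= eqxx.
by rewrite -eq_yx; apply: cons_red_id.
Qed.

Lemma fmul_reduced u v : reduced v -> reduced (fmul u v).
Proof. by move=> rv; elim: u => //= x u IH; apply: cons_red_reduced. Qed.

Lemma fmul_cat u v w : fmul (u ++ v) w = fmul u (fmul v w).
Proof. exact: foldr_cat. Qed.

Lemma fmul_id u v : reduced (u ++ v) -> fmul u v = u ++ v.
Proof.
elim: u => //= x u IH rxu; rewrite IH; first exact: cons_red_id.
exact: reduced_behead rxu.
Qed.

Lemma fmulu0 u : reduced u -> fmul u [::] = u.
Proof. by move=> ru; rewrite fmul_id ?cats0. Qed.

Lemma fmul_cons_red x u w :
  reduced w -> fmul (cons_red x u) w = cons_red x (fmul u w).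
Proof.
move=> rw; case: u => //= y u; case: eqP => //= ->.
by rewrite cons_redK // fmul_reduced.
Qed.

Lemma fmulA u v w : reduced w -> fmul u (fmul v w) = fmul (fmul u v) w.
Proof. by move=> rw; elim: u => //= x u ->; rewrite fmul_cons_red. Qed.

Lemma fmulK u w : reduced w -> fmul (finv u) (fmul u w) = w.
Proof.
move=> rw; elim: u => //= x u IH.
rewrite finv_cons -cats1 fmul_cat /=.
rewrite -{2}(inv_letterK x) cons_redK ?IH //; exact: fmul_reduced.
Qed.

Lemma fmulVK u w : reduced w -> fmul u (fmul (finv u) w) = w.
Proof. by move=> rw; rewrite -{1}(finvK u) fmulK. Qed.

Lemma fmulVu u : reduced u -> fmul (finv u) u = [::].
Proof. by move=> ru; rewrite -{2}(fmulu0 ru) fmulK. Qed.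

Lemma fmuluV u : reduced u -> fmul u (finv u) = [::].
Proof. by move=> ru; rewrite -{1}(finvK u) fmulVu // reduced_finv. Qed.

Lemma size_fmul u v : size (fmul u v) <= size u + size v.
Proof.
elim: u => //= x u IH; apply: leq_trans (_ : (size (fmul u v)).+1 <= _) => //.
by case: (fmul u v) => //= y w; case: ifP => //=; lia.
Qed.

(** Cancellation in a product is confined to one block [r], which enters [u] and [v] as mutually
    inverse words. An antisymmetric counting function therefore loses its contribution. *)
Lemma fmul_cancelP u v : reduced u -> reduced v ->
  exists u1 r v1, [/\ u = u1 ++ r, v = finv r ++ v1 & fmul u v = u1 ++ v1].
Proof.
move=> + rv; elim: u => [_|x u IH rxu]; first by exists [::], [::], v.
have [u1 [r [v1 [eu ev euv]]]] := IH (reduced_behead rxu).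
rewrite /= euv; case: u1 => [|y u1] in eu euv *; last first.
  exists (x :: y :: u1), r, v1; split => //; first by rewrite eu.
  by move: rxu; rewrite eu /= => /andP[/negPf->].
case: v1 => [|y v1] in ev euv *.
  by exists [:: x], r, [::]; split; rewrite ?eu.
rewrite /=; case: eqP => [eyx|_]; last by exists [:: x], r, (y :: v1); rewrite eu.
exists [::], (x :: r), v1; split => //; first by rewrite eu.
by rewrite ev finv_cons cat_rcons eyx.
Qed.

(** Cyclic reducedness takes the form [reduced (g0 ++ g0)], which makes all powers of [g0] plain
    concatenations ([reduced_npow]). *)
Lemma cyclic_reduction g : reduced g ->
  exists k g0, g = k ++ g0 ++ finv k /\ reduced (g0 ++ g0).
Proof.
have [N] := ubnP (size g); elim: N g => // N IH [|x g]; first by exists [::], [::].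
case/lastP: g => [|g y]; rewrite ltnS => le_gN rg.
  by exists [::], [:: x]; rewrite [_ ++ _]/= reduced_cons2 eq_sym inv_letter_neq.
have [exy|neq] := eqVneq x (inv_letter y); last first.
  exists [::], (x :: rcons g y); rewrite cats0; split => //.
  rewrite reduced_cat_cons rg andbT -rcons_cons -cats1 cat_rcons reduced_cat_cons.
  by rewrite rcons_cons rg reduced_cons2 neq.
have rg' : reduced g by apply: reduced_infix rg; rewrite -cats1 -cat1s infix_infix.
have lt_gN : size g < N by move: le_gN; rewrite /= size_rcons; lia.
have [k [g0 [eg rg0]]] := IH g lt_gN rg'.
exists (x :: k), g0; split => //.
by rewrite eg finv_cons exy inv_letterK -!cats1 /= -!catA.
Qed.

Definition npow g k : word n := flatten (nseq k g).

Lemma npowD g j k : npow g (j + k) = npow g j ++ npow g k.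
Proof. by rewrite /npow nseqD flatten_cat. Qed.

Lemma size_npow g k : size (npow g k) = k * size g.
Proof. by elim: k => //= k IH; rewrite size_cat IH mulSn. Qed.

Lemma reduced_npow g k : reduced (g ++ g) -> reduced (npow g k).
Proof.
case: g => [|x g] rg; first by elim: k.
elim: k => // -[|k] IH; first by case/cat_sorted2: rg => r1 _; rewrite /npow [flatten _]cats0.
rewrite -addn1 addnC npowD [npow _ 1]cats0.
by move: rg IH; rewrite [npow _ _]cat_cons !reduced_cat_cons => /andP[-> _].
Qed.

Lemma npowS g k : npow g k.+1 = g ++ npow g k.
Proof. by []. Qed.

Section Eval.
Variable B : 'I_n -> word n.

Lemma feval_reduced w : reduced (feval B w).
Proof. by elim: w => //= x w IH; apply: fmul_reduced. Qed.

Lemma feval_cons_red x w : feval B (cons_red x w) = feval B (x :: w).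
Proof.
case: w => //= y w; case: eqP => // -> /=.
by case: x => i [] /=; rewrite (fmulK, fmulVK) // feval_reduced.
Qed.

Lemma feval_fmul u v : feval B (fmul u v) = fmul (feval B u) (feval B v).
Proof.
elim: u => //= x u IH.
by rewrite feval_cons_red /= IH fmulA // feval_reduced.
Qed.

Lemma size_feval K : (forall i, size (B i) <= K) ->
  forall w, size (feval B w) <= size w * K.
Proof.
move=> leK; elim=> //= x w IH; rewrite mulSn.
apply: leq_trans (size_fmul _ _) (leq_add _ IH).
by case: ifP; rewrite ?size_finv.
Qed.

End Eval.

End FreeGroup.

(** * Whitehead's argument for separable elements *)

(* The Whitehead graph of such a word contains the complete bipartite graph
   between the letters and their inverses. *)
Definition positive_pairs n (w : word n) : Prop :=
  forall i j : 'I_n, infix [:: (i, false); (j, false)] w.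

Section Coloring.
Variables (n : nat) (n_gt1 : 1 < n) (c : word n -> bool) (N : nat) (g : word n).
(** The tree joins [p] to [x :: p], so the cone at [v] consists of the reduced words with suffix
    [v]. The isometric action is right multiplication; left multiplication by [g] moves [p] along
    the translate through [p] of the axis of [g]. *)
Hypothesis c_cone : forall x p, reduced (x :: p) -> N <= size p -> c (x :: p) = c p.
Hypothesis c_inv : forall p, reduced p -> c (fmul g p) = c p.
Hypothesis g_cyc : reduced (g ++ g).
Hypothesis g_pairs : positive_pairs g.

Lemma color_npow k p : reduced p -> c (fmul (npow g k) p) = c p.
Proof.
move=> rp; elim: k => //= k IH.
by rewrite [npow _ _]/= fmul_cat c_inv // fmul_reduced.
Qed.

Lemma color_cone s v : reduced (s ++ v) -> N <= size v -> c (s ++ v) = c v.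
Proof.
move=> + le_Nv; elim: s => // x s IH; rewrite cat_cons => rs.
have rs' := reduced_behead rs.
by rewrite c_cone ?IH // size_cat; lia.
Qed.

(* Some translate of the axis of g passes through the vertex v of the Cayley tree
   in the directions x_i and x_j^-1; p and q lie far out on its two rays. *)
Lemma axis_through v i j :
    reduced ((i, false) :: v) -> reduced ((j, true) :: v) ->
  exists s t, let p := s ++ (i, false) :: v in let q := t ++ (j, true) :: v in
    [/\ reduced p, reduced q, N <= size p, N <= size q & c p = c q].
Proof.
move=> ri rj; have /infixP[P [Q eg]] := g_pairs i j.
set y := (i, false) in ri eg *; set z := (j, false) in eg.
have ez : (j, true) = inv_letter z by [].
rewrite ez in rj *.
have g_gt0 : 0 < size g by rewrite eg size_cat /=; lia.
have le_N : N <= size (npow g N) by rewrite size_npow leq_pmulr.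
have eg1 : g = rcons P y ++ z :: Q by rewrite cat_rcons eg.
(* With g = P y z Q this gives p = g^N P y v and q = (z Q g^N)^-1 v, hence p = g^(2N+1) q. The N
   copies of the nonempty [g] make both words long enough. *)
exists (npow g N ++ P), (finv (Q ++ npow g N)) => p q.
have ep : p = (npow g N ++ rcons P y) ++ v by rewrite /p -!catA cat_rcons.
have eq : q = finv (z :: Q ++ npow g N) ++ v by rewrite finv_cons cat_rcons.
have rg2 k : reduced (npow g k) by apply: reduced_npow.
have eN : npow g N.+1 = (npow g N ++ rcons P y) ++ z :: Q.
  by rewrite -addn1 npowD [npow _ 1]cats0 -catA -eg1.
have eN' : npow g N.+1 = rcons P y ++ (z :: Q) ++ npow g N.
  by rewrite catA -eg1.
have rp : reduced p.
  rewrite /p reduced_cat_cons ri andbT -cats1 -catA cats1.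
  apply: reduced_infix (rg2 N.+1); rewrite eN; apply: prefix_infix.
have rq : reduced q.
  rewrite /q reduced_cat_cons rj andbT -finv_cons reduced_finv.
  apply: reduced_infix (rg2 N.+1); rewrite eN'; apply: suffix_infix.
have rv := reduced_behead ri.
have epq : p = fmul (npow g (N + N.+1)) q.
  have -> : q = fmul (finv (z :: Q ++ npow g N)) v by rewrite fmul_id -?eq.
  by rewrite npowD eN' catA fmul_cat [(_ :: _) ++ _]cat_cons fmulVK // fmul_id -?ep.
split=> //; last by rewrite epq color_npow.
  by rewrite /p !size_cat -addnA; apply: leq_trans le_N (leq_addr _ _).
by rewrite /q !size_cat size_finv size_cat addnAC; apply: leq_trans le_N (leq_addl _ _).
Qed.

Lemma color_const p q : reduced p -> reduced q -> N <= size p -> N <= size q ->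
  c p = c q.
Proof.
suff M d v : N - size v <= d -> reduced v -> forall s t,
    reduced (s ++ v) -> reduced (t ++ v) -> N <= size (s ++ v) ->
    N <= size (t ++ v) -> c (s ++ v) = c (t ++ v).
  by have := M N [::] _ isT p q; rewrite !cats0 subn0; apply.
elim: d v => [|d IH] v le_d rv s t rs rt le_s le_t.
  by rewrite !color_cone //; lia.
have [le_Nv|lt_vN] := leqP N (size v); first by rewrite !color_cone.
have cone a s1 s2 : reduced (s1 ++ a :: v) -> reduced (s2 ++ a :: v) ->
    N <= size (s1 ++ a :: v) -> N <= size (s2 ++ a :: v) ->
    c (s1 ++ a :: v) = c (s2 ++ a :: v).
  move=> r1 r2 le1 le2; apply: IH => //=; first lia.
  by move: r1; rewrite reduced_cat_cons => /andP[].
have join i j s1 s2 (a := (i, false)) (b := (j, true)) :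
    reduced (s1 ++ a :: v) -> reduced (s2 ++ b :: v) ->
    N <= size (s1 ++ a :: v) -> N <= size (s2 ++ b :: v) ->
    c (s1 ++ a :: v) = c (s2 ++ b :: v).
  move=> r1 r2 le1 le2.
  have ra : reduced (a :: v) by move: r1; rewrite reduced_cat_cons => /andP[].
  have rb : reduced (b :: v) by move: r2; rewrite reduced_cat_cons => /andP[].
  have [s3 [s4 [r3 r4 le3 le4 c34]]] := axis_through ra rb.
  by rewrite (cone _ s1 s3) // c34; apply: cone.
(* Some letter of sign [b] does not cancel against the head of [v], since there is a second
   generator. *)
have other b : exists j, reduced ((j, b) :: v).
  case: (v) rv => [|y w] rw; first by exists (Ordinal n_gt1).
  have [j neq_j] : exists j, j != y.1.
    have [e0|] := eqVneq (Ordinal n_gt1) y.1; last by exists (Ordinal n_gt1).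
    by exists (Ordinal (ltnW n_gt1)); rewrite -e0.
  exists j; rewrite reduced_cons2 rw andbT; apply: contra neq_j => /eqP ->.
  by rewrite /=.
have far b i : reduced ((i, ~~ b) :: v) ->
    exists j s1, reduced (s1 ++ (j, b) :: v) /\ N <= size (s1 ++ (j, b) :: v).
  have [j] := other b; case: b => /= r1 r2.
    by have [s1 [s2 [_ ? _ ? _]]] := axis_through r2 r1; exists j, s2.
  by have [s1 [s2 [? _ ? _ _]]] := axis_through r1 r2; exists j, s1.
have head_red u x : reduced (u ++ x :: v) -> reduced (x :: v).
  by rewrite reduced_cat_cons => /andP[].
case/lastP: s rs le_s => [|s [i a]]; first by move=> _; rewrite /=; lia.
case/lastP: t rt le_t => [|t [j b]]; first by move=> _; rewrite /=; lia.
rewrite !cat_rcons => rt le_t rs le_s.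
have := far (~~ a) i; rewrite negbK => /(_ (head_red _ _ rs)) [k [u [ru le_u]]].
(* Directions of opposite sign are joined directly, those of equal sign through the far vertex [u]
   in a direction of the other sign. *)
case: a b k u ru le_u rs le_s rt le_t => [] [] k u ru le_u rs le_s rt le_t.
- by rewrite -(join k i u s) // -(join k j u t).
- by rewrite (join j i t s).
- exact: join.
- by rewrite (join i k s u) // (join j k t u).
Qed.

End Coloring.

(** * Colourings defined by separable elements *)

Section Separable.
Variable n : nat.
Implicit Types (B : 'I_n -> word n) (u v w g : word n).

(** Expansion in the basis must be a function, because the colour will be a boolean function of it.
    Reducedness and equality of words are decidable, so [xchoose] applies; the value on nonreduced
    words is arbitrary. *)
Lemma basis_inverse B : is_basis B ->
  exists h, forall g, reduced g -> reduced (h g) /\ feval B (h g) = g.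
Proof.
case=> _ [_ surj].
have ex g : reduced g -> exists w, reduced w && (feval B w == g).
  by case/surj=> w [rw <-]; exists w; rewrite rw eqxx.
exists (fun g => if @idP (reduced g) is ReflectT rg then xchoose (ex g rg) else [::]).
move=> g rg; case: {-}_ / idP => // rg'.
by have /andP[? /eqP] := xchooseP (ex g rg').
Qed.

(** The default makes [last x [::] = x], so the empty word is excluded separately. *)
Definition ends_with x w := (w != [::]) && (last x w == x).

Lemma ends_with_cons_red x y w :
  (y.1 != x.1) || (1 < size w) -> ends_with x (cons_red y w) = ends_with x w.
Proof.
case: w => [|z [|z' w]] /=; rewrite ?orbF => neq.
- by rewrite /ends_with /=; apply: (contraNF _ neq) => /eqP->.
- have [->|//] := altP (z =P inv_letter y).
  by rewrite /ends_with /=; apply/esym/(contraNF _ neq) => /eqP <-.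
- by case: ifP.
Qed.

Lemma ends_with_fmul x u w : size u < size w ->
  ends_with x (fmul u w) = ends_with x w.
Proof.
(* The length bound guarantees that at least two letters remain before each further multiplication,
   so the last one is never cancelled. *)
move=> lt_uw; suff: size (fmul u w) + size u >= size w /\
  ends_with x (fmul u w) = ends_with x w by case.
elim: u lt_uw => [|y u IH] /= lt_uw; first by rewrite addn0.
have [//|le_w <-] := IH _; first lia.
split; last by rewrite ends_with_cons_red //; lia.
by case: (fmul u w) le_w => /= [|z v]; [|case: ifP => _ /=]; lia.
Qed.

Lemma ends_with_fmul_avoid i b u w : all (fun x => x.1 != i) u ->
  ends_with (i, b) (fmul u w) = ends_with (i, b) w.
Proof.
elim: u => //= y u IH /andP[neq /IH <-].
by rewrite ends_with_cons_red // neq.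
Qed.

(* The colour of p records on which side of a fixed edge of the Bass-Serre tree
   of F = H * <B i> (with g in H) the translate of the base vertex by p lies. *)
Lemma separable_color g : separable g -> exists (c : word n -> bool) N,
  [/\ forall x p, reduced (x :: p) -> N <= size p -> c (x :: p) = c p,
      forall p, reduced p -> c (fmul g p) = c p &
      exists p q, [/\ reduced p, reduced q, N <= size p, N <= size q & c p != c q]].
Proof.
case=> _ [B [S [hB [[g1 [rg1 ng1]] [w [wS eg]]]]]].
have [h hP] := basis_inverse hB.
have [i niS] : exists i, i \notin S.
  apply/existsP; apply: contra_notT ng1 => /existsPn allS.
  have [rh eh] := hP _ rg1; exists (h g1); split => //.
  by apply/allP => x _; rewrite -[_ \in _]negbK allS.
have heval u : reduced u -> h (feval B u) = u.
  move=> ru; have [rh eh] := hP _ (feval_reduced B u).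
  by case: hB => _ [inj _]; apply: inj.
have hcons x p : reduced (x :: p) -> h (x :: p) = fmul (h [:: x]) (h p).
  move=> rxp; have [rx ex] := hP [:: x] isT.
  have [rp ep] := hP _ (reduced_behead rxp).
  rewrite -[RHS]heval ?fmul_reduced // feval_fmul ex ep /=.
  by rewrite cons_red_id.
(* [K] and [K'] bound the stretching of lengths in the two changes of basis. *)
pose K := \max_i size (B i); pose K' := \max_x size (h [:: x]).
have leK u : size (feval B u) <= size u * K by apply: size_feval => j; apply: leq_bigmax.
have leK' p : reduced p -> size (h p) <= size p * K'.
  elim: p => [|x p IH] rp; first by rewrite -[[::]]/(feval B [::]) heval.
  rewrite hcons // mulSn; apply: leq_trans (size_fmul _ _) (leq_add _ _).
    exact: (leq_bigmax x).
  exact: IH (reduced_behead rp).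
(* If |p| >= N then |h p| > K' >= |h [:: x]|, so the prefix [h [:: x]] cannot reach the last letter
   of [h p]. *)
pose N := (K'.+1 * K).+1.
exists (fun p => ends_with (i, false) (h p)), N; split.
- move=> x p rxp le_N; have rp := reduced_behead rxp.
  rewrite hcons // ends_with_fmul //.
  apply: leq_ltn_trans (_ : K' < _); first exact: (leq_bigmax x).
  rewrite ltnNge; apply: contraL le_N => le_h; rewrite -ltnNge ltnS.
  have [_ {1}<-] := hP _ rp; apply: leq_trans (leK _) _.
  by rewrite leq_mul2r (leq_trans le_h) ?orbT.
- move=> p rp; have [rh eh] := hP _ rp.
  rewrite -{1}eh -eg -feval_fmul heval ?fmul_reduced //.
  apply: ends_with_fmul_avoid; apply/allP => x /(allP wS).
  by apply: contraTneq => ->.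
(* M letters over [B] cannot come from fewer than N standard letters. The powers of [B i] with
   exponents M and -M are then far from 1 and have different colours. *)
pose M := (N * K').+1.
have powP b : let u := nseq M (i, b) in reduced u /\ N <= size (feval B u).
  move=> u; have ru : reduced u.
    rewrite /u /M; elim: (N * K') => // k IH.
    by rewrite reduced_cons2 IH eq_sym inv_letter_neq.
  split=> //; have := leK' _ (feval_reduced B u).
  rewrite heval // size_nseq; apply: contraTT; rewrite -ltnNge => lt_N.
  by rewrite -ltnNge ltnS leq_mul2r ltnW ?orbT.
exists (feval B (nseq M (i, false))), (feval B (nseq M (i, true))).
have [[r1 l1] [r2 l2]] := (powP false, powP true).
split; rewrite ?feval_reduced ?heval //.
have endsE b : ends_with (i, false) (nseq M (i, b)) = ~~ b.
  rewrite /ends_with /M /=; elim: (N * K') => //=.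
  by rewrite xpair_eqE eqxx; case: b.
by rewrite !endsE.
Qed.

(** A word containing [w] inherits its positive pairs, so [color_const] would contradict the two
    colours of [separable_color]. The colour is also invariant under the inverse of [g]. *)
Lemma separable_no_positive_pairs g w : 1 < n -> separable g -> reduced (g ++ g) ->
  positive_pairs w -> ~~ infix w g && ~~ infix w (finv g).
Proof.
move=> n_gt1 sep_g rgg pairs_w.
have [c [N [c_cone c_inv [p [q [rp rq lp lq]]]]]] := separable_color sep_g.
move=> /negP nc; apply/andP; split; apply/negP => inf; apply/nc/eqP.
  have pairs_g : positive_pairs g by move=> i j; apply: infix_trans inf.
  exact: color_const pairs_g _ _ rp rq lp lq.
have pairs_g : positive_pairs (finv g) by move=> i j; apply: infix_trans inf.
apply: (color_const n_gt1 c_cone _ _ pairs_g rp rq lp lq).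
  by move=> r rr; rewrite -c_inv ?fmulVK // fmul_reduced.
by rewrite -finv_cat reduced_finv.
Qed.

(** Conjugating every basis element by [k] yields a basis for which the same [S] and the same word
    [w] serve. *)
Lemma separable_conj k g : reduced k -> separable g ->
  separable (fmul k (fmul g (finv k))).
Proof.
move=> rk [rg [B [S [hB [[g1 [rg1 ng1]] [w [wS eg]]]]]]].
have rV : reduced (finv k) by rewrite reduced_finv.
pose cj u := fmul k (fmul u (finv k)).
have rcj u : reduced (cj u) by do 2!apply: fmul_reduced.
have cjM u v : reduced v -> fmul (cj u) (cj v) = cj (fmul u v).
  move=> rv; rewrite /cj -!fmulA ?fmul_reduced //.
  by rewrite fmulK ?fmul_reduced.
have cj1 : cj [::] = [::] by rewrite /cj /= fmuluV.
have cjV u : reduced u -> finv (cj u) = cj (finv u).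
  move=> ru; have rVu : reduced (finv u) by rewrite reduced_finv.
  rewrite -[RHS](fmulK (cj u)) // cjM // fmuluV // cj1 fmulu0 //.
  by rewrite reduced_finv.
pose cj' u := fmul (finv k) (fmul u k).
have cjK u : reduced u -> cj' (cj u) = u.
  by move=> ru; rewrite /cj' /cj -!fmulA ?fmul_reduced // fmulVu // fmulu0 // fmulK.
have cjK' u : reduced u -> cj (cj' u) = u.
  by move=> ru; rewrite /cj' /cj -!fmulA ?fmul_reduced // fmuluV // fmulu0 // fmulVK.
have rcj' u : reduced (cj' u) by do 2!apply: fmul_reduced.
have evalE u : feval (fun i => cj (B i)) u = cj (feval B u).
  have [rB _] := hB.
  elim: u => [|[i b] u IH]; first by rewrite cj1.
  by rewrite /= IH; case: b => /=; rewrite ?cjV // cjM // feval_reduced.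
have [rB [inj surj]] := hB.
split; first exact: rcj.
exists (fun i => cj (B i)), S; split; last split.
- split=> //; split=> [u v ru rv|h rh].
    rewrite !evalE => /(congr1 cj'); rewrite !cjK ?feval_reduced //; exact: inj.
  have [u [ru eu]] := surj _ (rcj' h).
  by exists u; rewrite evalE eu cjK'.
- exists (cj g1); split=> // -[u [uS]]; rewrite evalE => /(congr1 cj').
  by rewrite !cjK ?feval_reduced // => eu; apply: ng1; exists u.
- by exists w; rewrite evalE eg.
Qed.

Lemma feval_letters u : feval (fun i : 'I_n => [:: (i, false)]) u = fmul u [::].
Proof. by elim: u => //= -[i b] u ->; case: b. Qed.

Lemma all_fmul (a : pred (letter n)) u v : all a u -> all a v -> all a (fmul u v).
Proof.
move=> + av; elim: u => //= x u IH /andP[ax /IH].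
by case: (fmul u v) => [|y w] /=; rewrite ?ax //; case: ifP => _ /=; rewrite ?ax // => /andP[].
Qed.

Lemma separable_letter (x : letter n) : 1 < n -> separable [:: x].
Proof.
move=> n_gt1; split=> //.
exists (fun i => [:: (i, false)]), [set x.1]; split; last split.
- split=> //; split=> [u v ru rv|g rg]; first by rewrite !feval_letters !fmulu0.
  by exists g; rewrite feval_letters fmulu0.
- have [j neq_j] : exists j, j != x.1.
    have [e0|] := eqVneq (Ordinal n_gt1) x.1; last by exists (Ordinal n_gt1).
    by exists (Ordinal (ltnW n_gt1)); rewrite -e0.
  exists [:: (j, false)]; split=> // -[w [wS]]; rewrite feval_letters => ew.
  by have := all_fmul wS (isT : all _ [::]); rewrite ew /= in_set1 andbT (negPf neq_j).
- by exists [:: x]; rewrite feval_letters /= set11.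
Qed.

End Separable.

(** * Counting quasimorphisms *)

Section Occurrences.
Variable T : eqType.
Implicit Types (s t w : seq T).

(** Overlapping occurrences all count. *)
Fixpoint occ w s : nat :=
  if s is _ :: s' then prefix w s + occ w s' else 0.

Lemma occ_cons w x s : occ w (x :: s) = prefix w (x :: s) + occ w s.
Proof. by []. Qed.

Lemma occ_cat_ge w s t : w != [::] -> occ w s + occ w t <= occ w (s ++ t).
Proof.
move=> w_n0; elim: s => [|x s IH]; first by rewrite add0n.
rewrite cat_cons !occ_cons -addnA leq_add //.
have := @prefix_catl _ w (x :: s) t; rewrite cat_cons.
by case: (prefix w (x :: s)) => // ->.
Qed.

Lemma occ_cat_le w s t : occ w (s ++ t) <= occ w s + occ w t + size w.
Proof.
(* Only occurrences straddling the cut are new. The minimum grows exactly while [s] is too short to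
   contain [w], which is when the prefix test can change. *)
suff: occ w (s ++ t) <= occ w s + occ w t + minn (size s) (size w) by lia.
elim: s => [|x s IH]; first by rewrite min0n addn0.
rewrite cat_cons !occ_cons.
have [le_w|lt_w] := leqP (size w) (size (x :: s)).
  have ->: prefix w (x :: s ++ t) = prefix w (x :: s).
    by rewrite -cat_cons !prefixE takel_cat.
  by move: le_w IH => /=; lia.
by move: lt_w IH; rewrite /= => lt_w IH; case: (prefix w (x :: s ++ t)); lia.
Qed.

Lemma occ_infixN w s : ~~ infix w s -> occ w s = 0.
Proof.
elim: s => // x s IH; rewrite infix_consl negb_or => /andP[/negPf np /IH occ0].
by rewrite occ_cons np occ0.
Qed.

Lemma occ_self w : w != [::] -> 0 < occ w w.
Proof. by case: w => // x w _; rewrite occ_cons prefix_refl. Qed.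

End Occurrences.

Section Brooks.
Variable n : nat.
Implicit Types (u v w g : word n).
Local Open Scope ring_scope.

(* The occurrences of w in u^-1 correspond to those of w^-1 in u. *)
Definition brooks w u : int := (occ w u)%:Z - (occ w (finv u))%:Z.

Lemma brooks_finv w u : brooks w (finv u) = - brooks w u.
Proof. by rewrite /brooks finvK GRing.opprB. Qed.

Lemma brooks_cat w u v : w != [::] ->
  (`|(brooks w (u ++ v) - (brooks w u + brooks w v))%R| <= size w)%N.
Proof.
move=> w0; rewrite /brooks finv_cat.
have bounds (s t : word n) : (occ w s + occ w t <= occ w (s ++ t) <= occ w s + occ w t + size w)%N.
  by rewrite occ_cat_ge ?occ_cat_le.
have := bounds u v; have := bounds (finv v) (finv u).
lia.
Qed.

(** One error of |w| arises at each of the junctions u1|r, r^-1|v1 and u1|v1; the values on [r] and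
    its inverse cancel. *)
Lemma brooks_fmul w u v : w != [::] -> reduced u -> reduced v ->
  (`|(brooks w (fmul u v) - (brooks w u + brooks w v))%R| <= 3 * size w)%N.
Proof.
move=> w0 ru rv; have [u1 [r [v1 [-> -> ->]]]] := fmul_cancelP ru rv.
have := brooks_cat u1 v1 w0; have := brooks_cat u1 r w0.
have := brooks_cat (finv r) v1 w0; rewrite brooks_finv; lia.
Qed.

(** The value on the cyclically reduced core vanishes and those on the conjugators cancel; the two
    junctions remain. *)
Lemma brooks_separable w g : (1 < n)%N -> w != [::] -> positive_pairs w ->
  separable g -> (`|brooks w g| <= 2 * size w)%N.
Proof.
move=> n_gt1 w0 pairs_w sep_g; have [rg _] := sep_g.
have [k [g0 [eg rg0]]] := cyclic_reduction rg.
have rk : reduced (finv k).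
  by apply: reduced_infix rg; rewrite eg catA suffix_infix.
have rg01 : reduced g0 by case/cat_sorted2: rg0.
have sep_g0 : separable g0.
  have := separable_conj rk sep_g.
  by rewrite finvK eg !fmul_cat fmulVu -1?reduced_finv // fmulu0 // fmulK.
have /andP[nw nwV] := separable_no_positive_pairs n_gt1 sep_g0 rg0 pairs_w.
have b0 : brooks w g0 = 0 by rewrite /brooks !occ_infixN.
have := brooks_cat k (g0 ++ finv k) w0; have := brooks_cat g0 (finv k) w0.
rewrite -eg brooks_finv b0; lia.
Qed.

(** Each edge costs 3|w| for the product and 2|w| for the separable factor. *)
Lemma brooks_path w p h k : (1 < n)%N -> w != [::] -> positive_pairs w ->
  reduced p -> cay_dist_le p h k ->
  (`|brooks w h - brooks w p| <= 5 * size w * k)%N.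
Proof.
move=> n_gt1 w0 pairs_w rp [path [le_k [sep ->]]].
suff: (`|brooks w (foldr (fun e acc => fmul (step e) acc) p path) - brooks w p|
   <= 5 * size w * size path)%N.
  by move=> h1; apply: leq_trans h1 _; rewrite leq_mul2l le_k orbT.
elim: path sep {le_k} => [_|[s b] path IH sep]; first by rewrite /= GRing.subrr.
have /IH {IH} : forall e, e \in path -> separable e.1.
  by move=> e ein; apply: sep; rewrite inE ein orbT.
have := sep (s, b) (mem_head _ _); rewrite /= => sep_s.
have bs := brooks_separable n_gt1 w0 pairs_w sep_s; have [rs _] := sep_s.
set q := foldr _ _ _.
have rq : reduced q by rewrite /q; elim: (path) => //= e l; apply: fmul_reduced.
have rstep : reduced (step (s, b)) by case: b {sep}; rewrite /step /= ?reduced_finv.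
have bstep : (`|brooks w (step (s, b))| <= 2 * size w)%N.
  by case: b {sep rstep}; rewrite /step /= ?brooks_finv; move: bs; lia.
have := brooks_fmul w0 rstep rq.
move: bstep; rewrite /=; nia.
Qed.

End Brooks.

(** * The quasi-isometric embedding *)

Section Distance.
Variable n : nat.
Implicit Types (p q u v : word n).

Lemma cay_dist_refl p : cay_dist_le p p 0.
Proof. by exists [::]. Qed.

Lemma cay_dist_trans p q u j k :
  cay_dist_le p q j -> cay_dist_le q u k -> cay_dist_le p u (j + k).
Proof.
move=> [s [le_j [sep_s ->]]] [t [le_k [sep_t ->]]].
exists (t ++ s); split; first by rewrite size_cat addnC leq_add.
split; last by rewrite foldr_cat.
by move=> e; rewrite mem_cat => /orP[/sep_t|/sep_s].
Qed.

Lemma cay_dist_leq p q j k : j <= k -> cay_dist_le p q j -> cay_dist_le p q k.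
Proof. by move=> le_jk [s [le_j sep_s]]; exists s; split=> //; apply: leq_trans le_jk. Qed.

(* bi-invariance: inserting u in the middle of a product amounts to multiplying
   on the left by the conjugates by p of the letters of u *)
Lemma cay_dist_insert p u q : 1 < n -> reduced p -> reduced q ->
  cay_dist_le (fmul p q) (fmul p (fmul u q)) (size u).
Proof.
move=> n_gt1 rp rq; elim: u => [|x u IH]; first exact: cay_dist_refl.
rewrite /= -addn1; apply: cay_dist_trans IH _.
exists [:: (fmul p (fmul [:: x] (finv p)), false)]; split=> //; split.
  move=> e; rewrite inE => /eqP->.
  by apply: (separable_conj (g := [:: x])) => //; apply: separable_letter.
have rV : reduced (finv p) by rewrite reduced_finv.
have rz : reduced (fmul u q) by apply: fmul_reduced.
rewrite -[RHS]/(fmul (fmul p (fmul [:: x] (finv p))) (fmul p (fmul u q))).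
by rewrite -!fmulA ?fmulK ?fmul_reduced.
Qed.

End Distance.

(** * Integer powers of a cyclically reduced word *)

Section Powers.
Variables (n : nat) (g : word n).
Hypothesis g_cyc : reduced (g ++ g).
Local Open Scope ring_scope.

Definition zpow (z : int) : word n :=
  match z with Posz k => npow g k | Negz k => finv (npow g k.+1) end.

Lemma zpow_reduced z : reduced (zpow z).
Proof. by case: z => k; rewrite /zpow ?reduced_finv reduced_npow. Qed.

Lemma size_zpow z : size (zpow z) = (`|z| * size g)%N.
Proof. by case: z => k; rewrite /zpow ?size_finv size_npow. Qed.

Lemma zpowS z : zpow (z + 1) = fmul g (zpow z).
Proof.
have rg : reduced g by case/cat_sorted2: g_cyc.
case: z => [k|[|k]].
- have ->: (Posz k + 1 = Posz k.+1)%R by lia.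
  by rewrite /zpow fmul_id //; apply: (reduced_npow k.+1).
- by rewrite /zpow [npow g 1]cats0 fmuluV.
have ->: (Negz k.+1 + 1 = Negz k)%R by lia.
rewrite /zpow -[k.+2]addn1 npowD [npow g 1]cats0 finv_cat -fmul_id ?fmulVK //.
  by rewrite reduced_finv reduced_npow.
by rewrite -finv_cat reduced_finv -{2}[g]cats0 -(npowD g _ 1) reduced_npow.
Qed.

Lemma zpow_addn (k : nat) z : zpow (k%:Z + z) = fmul (npow g k) (zpow z).
Proof.
elim: k => [|k IH]; first by rewrite GRing.add0r.
have ->: (Posz k.+1 + z = (Posz k + z) + 1)%R by lia.
by rewrite zpowS IH [npow g k.+1]/= fmul_cat.
Qed.

Lemma zpowD y z : zpow (y + z) = fmul (zpow y) (zpow z).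
Proof.
case: y => k; first exact: zpow_addn.
(* Splitting off g^(k+1) from the second factor cancels a negative first power and reduces to
   [zpow_addn]. *)
have e : z = Posz k.+1 + (Negz k + z) by lia.
by rewrite [in RHS]e zpow_addn /zpow fmulK //; apply: zpow_reduced.
Qed.

End Powers.

(** * Positive words and the choice of the words [g i] *)

Section PositiveWords.
Variable n : nat.
Implicit Types (u v w g : word n).

Definition positive w := all (fun x : letter n => ~~ x.2) w.

Lemma positive_reduced w : positive w -> reduced w.
Proof.
elim: w => // x [|y w] IH // pos_w; have /and3P[px py pw] := pos_w.
rewrite reduced_cons2 IH ?andbT; last by case/andP: pos_w.
by apply: contraNneq py => ->; rewrite /= px.
Qed.

Lemma positive_npow g k : positive g -> positive (npow g k).
Proof.
by move=> pg; elim: k => // k IH; rewrite /positive all_cat; apply/andP.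
Qed.

Lemma positive_finv_infixN g w : g != [::] -> positive g -> positive w ->
  ~~ infix g (finv w).
Proof.
case: g => // x g _ /andP[px _] pw; apply/negP => /infixP[s [t e]].
have : inv_letter x \in w.
  rewrite -(mem_map (can_inj (@inv_letterK n))) inv_letterK -mem_rev.
  by rewrite -[rev _]/(finv w) e mem_cat mem_head orbT.
by move/(allP pw); rewrite /= negbK (negPf px).
Qed.

(* A window of length |g| in a power of g is a rotation of g. *)
Lemma count_window a g w k : size w = size g -> infix w (npow g k) ->
  count a w = count a g.
Proof.
move=> eq_sz /infixP[s [t]].
elim: k s => [|k IH] s e.
  have w0 : w = [::] by case: w e {eq_sz} => //; case: s.
  by rewrite w0 in eq_sz *; rewrite (size0nil (esym eq_sz)).
rewrite npowS in e.
have [le_gs|/ltnW le_sg] := leqP (size g) (size s).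
  apply: (IH (drop (size g) s)).
  move: e; rewrite -{1}(cat_take_drop (size g) s) -catA => /eqP.
  by rewrite eqseq_cat ?size_takel // => /andP[_ /eqP].
(* The window now starts inside the first copy g = s d, and its length forces it to be d s. If that
   copy is the only one, then [s] and [t] are empty. *)
have [d eg] : exists d, g = s ++ d.
  exists (drop (size s) g); rewrite -{1}(cat_take_drop (size s) g); congr cat.
  by have := congr1 (take (size s)) e; rewrite take_size_cat // takel_cat.
rewrite {}eg in eq_sz e *; rewrite size_cat in eq_sz.
have {}e : d ++ npow (s ++ d) k = w ++ t.
  by move: e => /eqP; rewrite -catA eqseq_cat // eqxx => /eqP.
case: k {IH le_sg} e => [|k] e.
  have := congr1 size e; rewrite size_cat size_npow addn0 size_cat eq_sz addnAC.
  rewrite -{1}[size d]add0n => /addIn/esym/eqP.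
  rewrite addn_eq0 => /andP[/eqP/size0nil s0 /eqP/size0nil t0].
  by move: e; rewrite s0 t0 !cats0 => ->.
move: e; rewrite npowS -catA (catA d) => /eqP.
rewrite eqseq_cat; last by rewrite eq_sz size_cat addnC.
by case/andP=> /eqP <- _; rewrite !count_cat addnC.
Qed.

Definition all_pairs_word : word n :=
  flatten [seq [:: (i, false); (j, false)] | i <- enum 'I_n, j <- enum 'I_n].

Lemma positive_all_pairs_word : positive all_pairs_word.
Proof.
apply/allP => x /flattenP[w /allpairsP[[i j] [_ _ ->]]].
by rewrite !inE => /orP[] /eqP->.
Qed.

Lemma positive_pairs_all_pairs_word v : positive_pairs (all_pairs_word ++ v).
Proof.
move=> i j; apply: infix_trans (prefix_infix _ _); rewrite /all_pairs_word.
have : [:: (i, false); (j, false)] \in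
    [seq [:: (i, false); (j, false)] | i <- enum 'I_n, j <- enum 'I_n].
  by apply/allpairsP; exists (i, j); rewrite !mem_enum.
by case/splitPr => s t; rewrite flatten_cat; apply: infix_infix.
Qed.

End PositiveWords.

(** The block a^i b^(m-i) lets the number of letters [a] determine i while the length stays fixed;
    the common prefix [U] supplies all positive pairs. *)
Lemma marker_family n m : 1 < n -> exists (g : 'I_m -> word n) (l : nat) (a : letter n),
  [/\ forall i, positive (g i), forall i, positive_pairs (g i),
      0 < l, forall i, size (g i) = l & injective (fun i => count_mem a (g i))].
Proof.
move=> n_gt1; pose a : letter n := (Ordinal n_gt1, false).
pose b : letter n := (Ordinal (ltnW n_gt1), false).
pose U := all_pairs_word n.
exists (fun i => U ++ nseq i a ++ nseq (m - i) b), (size U + m), a.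
have U_gt0 : 0 < size U.
  have := positive_pairs_all_pairs_word [::] (Ordinal n_gt1) (Ordinal n_gt1).
  by rewrite cats0 -/U; case: U => // /infixP[[|? ?] [t]].
split; last 3 first.
- by rewrite addn_gt0 U_gt0.
- by move=> i; rewrite !size_cat !size_nseq; have := ltn_ord i; lia.
- move=> i j; rewrite !count_cat !count_nseq.
  rewrite [pred1 a a]eqxx [pred1 a b](_ : _ = false) //.
  by move=> e; apply: val_inj => /=; lia.
- move=> i; rewrite /positive !all_cat !all_nseq /= !orbT !andbT.
  exact: positive_all_pairs_word.
- by move=> i; apply: positive_pairs_all_pairs_word.
Qed.

Section Embedding.
Variables (n m l : nat) (a : letter n) (g : 'I_m -> word n).
Hypotheses (n_gt1 : 1 < n) (l_gt0 : 0 < l) (g_size : forall i, size (g i) = l).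
Hypotheses (g_pos : forall i, positive (g i)) (g_pairs : forall i, positive_pairs (g i)).
Hypothesis g_count : injective (fun i => count_mem a (g i)).
Implicit Types (i j : 'I_m) (s : seq 'I_m) (x y : 'I_m -> int).

Let g_cyc i : reduced (g i ++ g i).
Proof. by apply: positive_reduced; rewrite /positive all_cat; apply/andP; split; apply: g_pos. Qed.

Let g_neq0 i : g i != [::].
Proof. by rewrite -size_eq0 g_size -lt0n. Qed.

(** Superadditivity gives one occurrence per factor of a positive power, and the inverse of a
    positive word contributes none. *)
Lemma brooks_zpow_self i z : `|z|%N <= `|brooks (g i) (zpow (g i) z)|%N.
Proof.
have le_npow k : k <= `|brooks (g i) (npow (g i) k)|%N.
  rewrite /brooks [occ _ (finv _)]occ_infixN; last first.
    by apply: positive_finv_infixN; rewrite ?positive_npow.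
  rewrite GRing.subr0 /=; elim: k => // k IH.
  by rewrite npowS (leq_trans _ (occ_cat_ge _ _ (g_neq0 i))) // -add1n leq_add // occ_self.
by case: z => k; rewrite /zpow ?brooks_finv ?abszN; apply: le_npow.
Qed.

Lemma brooks_zpow_other i j z : i != j -> brooks (g i) (zpow (g j) z) = 0%R.
Proof.
move=> neq_ij.
have b0 k : brooks (g i) (npow (g j) k) = 0%R.
  rewrite /brooks !occ_infixN //.
    by apply: positive_finv_infixN; rewrite ?positive_npow.
  apply: contra neq_ij => inf; apply/eqP/g_count.
  by apply: count_window inf; rewrite !g_size.
by case: z => k; rewrite /zpow ?brooks_finv b0 ?GRing.oppr0.
Qed.

Definition zprod s x : word n := foldr (fun i acc => fmul (zpow (g i) (x i)) acc) [::] s.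

Lemma zprod_reduced s x : reduced (zprod s x).
Proof. by elim: s => //= i s IH; apply: fmul_reduced. Qed.

(** Coordinates are changed one at a time from the right; [p] collects the unchanged powers on the
    left, and the difference power is inserted right after it. *)
Lemma zprod_upper p s x y : reduced p ->
  cay_dist_le (fmul p (zprod s x)) (fmul p (zprod s y)) (l * \sum_(i <- s) `|x i - y i|%N).
Proof.
elim: s p => [|i s IH] p rp; first by rewrite big_nil muln0; apply: cay_dist_refl.
have rz z := zpow_reduced (g_cyc i) z.
have rs := zprod_reduced s y.
rewrite big_cons mulnDr addnC /=; apply: cay_dist_trans.
  rewrite (fmulA _ _ (zprod_reduced s x)); apply: IH; exact: fmul_reduced.
rewrite -fmulA //.
have -> : zpow (g i) (y i) = fmul (zpow (g i) (y i - x i)%R) (zpow (g i) (x i)).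
  by rewrite -zpowD // GRing.subrK.
rewrite -fmulA //.
apply: cay_dist_leq (cay_dist_insert (zpow (g i) (y i - x i)%R) n_gt1 rp _).
  by rewrite size_zpow g_size mulnC distnC.
exact: fmul_reduced.
Qed.

Lemma brooks_zprod i s x :
  `|(brooks (g i) (zprod s x) - \sum_(j <- s) brooks (g i) (zpow (g j) (x j)))%R|%N
    <= 3 * l * size s.
Proof.
elim: s => [|j s IH]; first by rewrite big_nil GRing.subr0 /brooks /=.
have := brooks_fmul (g_neq0 i) (zpow_reduced (g_cyc j) (x j)) (zprod_reduced s x).
rewrite big_cons g_size -[size (_ :: _)]/(size s).+1 mulnS.
have tri (a1 a2 b1 b2 : int) d e : `|(a1 - a2)%R| <= d ->
  `|(b1 - (b2 + a1))%R| <= e -> `|(b1 - (b2 + a2))%R| <= e + d by lia.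
exact: tri IH.
Qed.

Lemma brooks_zprod_enum i x :
  `|(brooks (g i) (zprod (enum 'I_m) x) - brooks (g i) (zpow (g i) (x i)))%R|%N
    <= 3 * l * m.
Proof.
have := brooks_zprod i (enum 'I_m) x; rewrite size_enum_ord big_enum /= (bigD1 i) //=.
rewrite big1 ?GRing.addr0 // => j; rewrite eq_sym; exact: brooks_zpow_other.
Qed.

(** The path contributes 5lk, the evaluation at each of the two endpoints 3lm, and the splitting of
    the power y_i into the powers y_i - x_i and x_i another 3l. *)
Lemma zprod_lower x y k i : cay_dist_le (zprod (enum 'I_m) x) (zprod (enum 'I_m) y) k ->
  `|x i - y i| <= 5 * l * k + 3 * l * (2 * m + 1).
Proof.
move=> /(brooks_path n_gt1 (g_neq0 i) (g_pairs i) (zprod_reduced _ x)).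
have rz z := zpow_reduced (g_cyc i) z.
have := brooks_fmul (g_neq0 i) (rz (y i - x i)%R) (rz (x i)).
have := brooks_zprod_enum i x; have := brooks_zprod_enum i y.
have := brooks_zpow_self i (y i - x i)%R.
rewrite -zpowD // GRing.subrK g_size distnC; lia.
Qed.

Lemma zprod_qi : qi_embedding (zprod (enum 'I_m)).
Proof.
split=> [x|]; first exact: zprod_reduced.
(* Summing [zprod_lower] over the m coordinates leads to these constants; [m.+1] keeps the first one
   positive for m = 0. *)
exists (5 * l * m.+1), (2 * m + 1); split; first by rewrite !muln_gt0 l_gt0.
move=> x y; split=> [|k dist_k].
  apply: cay_dist_leq (zprod_upper (enum 'I_m) x y (isT : reduced [::])).
  rewrite /l1dist big_enum /=.
  by apply: leq_trans (leq_addr _ _); rewrite leq_mul2r; apply/orP; right; nia.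
rewrite /l1dist; apply: leq_trans (_ : m * (5 * l * k + 3 * l * (2 * m + 1)) <= _).
  have -> : m * (5 * l * k + 3 * l * (2 * m + 1)) =
      \sum_(i < m) (5 * l * k + 3 * l * (2 * m + 1)) by rewrite sum_nat_const card_ord.
  by apply: leq_sum => i _; apply: zprod_lower dist_k.
nia.
Qed.

End Embedding.

Theorem mainTheorem8 (n : nat) (hn : 2 <= n) (m : nat) :
  exists f : ('I_m -> int) -> word n, qi_embedding f.
Proof.
have [g [l [a [g_pos g_pairs l_gt0 g_size g_count]]]] := marker_family m hn.
by exists (zprod g (enum 'I_m)); apply: (zprod_qi hn l_gt0 g_size g_pos g_pairs g_count).
Qed.
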